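(* Let $c$ and $m$ be positive integers with $c>1$. If $m$ divides $c-1$ and $\operatorname{cosocle}(m)>\operatorname{rad}(c)$, then $(1,c^{k}-1,c^{k})$ is an $abc$ triple for each positive integer $k$.
   Context: For a positive integer $n$, $\operatorname{rad}(n)$ denotes the product of the distinct prime factors of $n$ (with $\operatorname{rad}(1)=1$), and $\operatorname{cosocle}(n)=\frac{n}{\operatorname{rad}(n)}$. An $abc$ triple is a triple $(a,b,c)$ of relatively prime positive integers with $a+b=c$ and $\operatorname{rad}(abc)<c$. *)

(* Defs.v *)
From mathcomp Require Import all_boot.

Set Implicit Arguments.
Unset Strict Implicit.
Unset Printing Implicit Defensive.

(* [primes n] is duplicate-free, and empty for n = 1, so that rad 1 = 1. *)
Definition rad (n : nat) : nat := \prod_(p <- primes n) p.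

(* For n > 0 the division is exact, since rad n divides n. *)
Definition cosocle (n : nat) : nat := n %/ rad n.

(* Coprimality is required pairwise; under a + b = c this is equivalent to
   gcd(a, b, c) = 1. *)
Definition abc_triple (a b c : nat) : Prop :=
  [/\ [/\ 0 < a, 0 < b & 0 < c],
      [/\ coprime a b, coprime a c & coprime b c],
      a + b = c
    & rad (a * b * c) < c].

(* Main.v *)
(* Write c^k - 1 = m q.  Then rad (c^k - 1) <= rad m * q, while
   rad (c^k) = rad c < m / rad m, so the product of the two radicals is less
   than m q = c^k - 1. *)
Require Import Defs.
From mathcomp Require Import all_boot.

(** As [c - 1] divides [c ^ k - 1], so does [m]. Put [n = c ^ k - 1]. A divisor [m] of [n] forces
    [rad n * cosocle m <= n] ([rad_mul_cosocle_leq]). Powers keep their radical, so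
    [rad (c ^ k) = rad c < cosocle m], and submultiplicativity ([radM_leq]) bounds the radical of
    [n * c ^ k] strictly below [n]. *)

Lemma rad_gt0 n : 0 < rad n.
Proof.
by rewrite /rad big_seq prodn_cond_gt0 // => p /[!mem_primes] /andP[/prime_gt0].
Qed.

Lemma rad_leq n : 0 < n -> rad n <= n.
Proof.
move=> n_gt0; rewrite [leqRHS](prod_prime_decomp n_gt0) prime_decompE big_map.
rewrite /rad !big_seq; apply: leq_prod => p p_n /=.
rewrite -{1}[p]expn1 leq_pexp2l ?logn_gt0 //.
by move: p_n; rewrite mem_primes => /andP[/prime_gt0].
Qed.

Lemma rad_exp n k : 0 < k -> rad (n ^ k) = rad n.
Proof. by move=> k_gt0; rewrite /rad primesX. Qed.

(** A prime common to [a] and [b] counts once on the left, twice on the right. *)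
Lemma radM_leq a b : 0 < a -> 0 < b -> rad (a * b) <= rad a * rad b.
Proof.
move=> a_gt0 b_gt0; rewrite /rad.
have -> : \prod_(p <- primes (a * b)) p =
    \prod_(p <- primes a ++ [seq p <- primes b | p \notin primes a]) p.
  apply/perm_big/uniq_perm; rewrite ?primes_uniq //.
    rewrite cat_uniq filter_uniq ?primes_uniq // andbT -all_predC.
    by apply/allP => p; rewrite mem_filter => /andP[].
  move=> p; rewrite primesM // mem_cat mem_filter.
  by case: (p \in primes a).
(* The primes of [b] that also divide [a] contribute a positive factor, which is dropped. *)
rewrite big_cat leq_mul2l big_filter [leqRHS](bigID (fun p => p \notin primes a)).
rewrite /= leq_pmulr ?orbT // big_seq_cond prodn_cond_gt0 // => p.
by rewrite mem_primes => /andP[/andP[/prime_gt0]].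
Qed.

(** With [n = q * m], the radical of [q] is bounded by [q] itself, and [rad m * cosocle m <= m]
    holds even for truncated division. *)
Lemma rad_mul_cosocle_leq m n : 0 < n -> m %| n -> rad n * cosocle m <= n.
Proof.
move=> n_gt0 /dvdnP[q n_eq]; move: n_gt0; rewrite n_eq muln_gt0.
case/andP=> q_gt0 m_gt0.
apply: (@leq_trans (q * rad m * cosocle m)).
  rewrite leq_mul2r; apply/orP; right.
  by apply: leq_trans (radM_leq _ _ q_gt0 m_gt0) _; rewrite leq_mul2r rad_leq ?orbT.
by rewrite -mulnA leq_mul2l mulnC leq_divM orbT.
Qed.

Theorem theorem1 (c m : nat) (c_gt0 : 0 < c) (m_gt0 : 0 < m) (c_gt1 : 1 < c)
    (m_dvd : m %| c - 1) (hm : rad c < cosocle m) :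
  forall k : nat, 0 < k -> abc_triple 1 (c ^ k - 1) (c ^ k).
Proof.
move=> k k_gt0.
have ck_gt1 : 1 < c ^ k by rewrite -(exp1n k) ltn_exp2r.
have ck_gt0 := ltnW ck_gt1.
have n_gt0 : 0 < c ^ k - 1 by rewrite subn_gt0.
have m_dvdn : m %| c ^ k - 1.
  (* Reading [1] as [1 ^ k] lets [c - 1] factor out of a difference of powers. *)
  by apply: dvdn_trans m_dvd _; rewrite -{2}(exp1n k) subn_exp dvdn_mulr.
split; rewrite ?subnKC //.
  by rewrite !coprime1n subn1 coprimePn.
rewrite mul1n; apply: leq_ltn_trans (radM_leq _ _ n_gt0 ck_gt0) _.
rewrite rad_exp //.
have lt_rad : rad (c ^ k - 1) * rad c < rad (c ^ k - 1) * cosocle m.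
  by rewrite ltn_pmul2l ?rad_gt0.
apply: leq_trans lt_rad _.
by apply: leq_trans (rad_mul_cosocle_leq _ _ n_gt0 m_dvdn) _; rewrite leq_subr.
Qed.
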